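(* Assume MA($\sigma$-centered). Let $\mathcal{I}$ and $\mathcal{J}$ be ideals such that $\mathcal{I}\subseteq\mathcal{I}'$ for some coanalytic hereditary weak P-ideal $\mathcal{I}'$ with $\mathcal{J}\not\leq_K\mathcal{I}'$. Then there is a Mr\'owka space in $\mathrm{FinBW}(\mathcal{I})\setminus\mathrm{FinBW}(\mathcal{J})$.
   Context: An ideal on an infinite countable set $X$ is a family $\mathcal{I}\subseteq\mathcal{P}(X)$ closed under subsets and finite unions, containing all finite subsets, with $X\notin\mathcal{I}$; identifying subsets of $X$ with points of $2^X$ (product topology) one speaks of coanalytic ideals. $\mathcal{I}|A=\{B\cap A:B\in\mathcal{I}\}$. A space $X$ is in $\mathrm{FinBW}(\mathcal{I})$ if $X$ is Hausdorff and for every sequence $(x_n)_{n\in\bigcup\mathcal{I}}$ in $X$ there is $A\notin\mathcal{I}$ with $(x_n)_{n\in A}$ convergent in $X$. $\mathcal{J}\leq_K\mathcal{I}$: there is a function $f:\bigcup\mathcal{I}\to\bigcup\mathcal{J}$ with $f^{-1}[B]\in\mathcal{I}$ for all $B\in\mathcal{J}$. $\mathrm{Fin}^2$: ideal on $\omega^2$ of all $A$ with only finitely many $n$ such that $\{m:(n,m)\in A\}$ is infinite. $\mathcal{I}\sqsubseteq\mathcal{J}$: there is a bijection $f:\bigcup\mathcal{J}\to\bigcup\mathcal{I}$ with $f^{-1}[A]\in\mathcal{J}$ for all $A\in\mathcal{I}$. $\mathcal{I}$ is a hereditary weak P-ideal if $\mathrm{Fin}^2\not\sqsubseteq\mathcal{I}|A$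 for every $A\notin\mathcal{I}$. A Mr\'owka space is $\Phi(\mathcal{A})$ for an infinite almost disjoint family $\mathcal{A}$ of infinite subsets of $\omega$: underlying set $\omega\cup\mathcal{A}\cup\{\infty\}$, points of $\omega$ isolated, basic neighbourhoods of $A\in\mathcal{A}$ are $\{A\}\cup(A\setminus F)$ ($F\subseteq\omega$ finite), of $\infty$ are $\{\infty\}\cup(\mathcal{A}\setminus G)\cup(\omega\setminus(F\cup\bigcup G))$ ($F\subseteq\omega$, $G\subseteq\mathcal{A}$ finite). *)

(* Defs.v *)
From Stdlib Require Import List.
Import ListNotations.
Set Implicit Arguments.

Definition pset (X : Type) := X -> Prop.

Definition finite_set (X : Type) (S : pset X) : Prop :=
  exists l : list X, forall x, S x -> In x l.

Definition countably_infinite (X : Type) : Prop :=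
  exists (f : nat -> X) (g : X -> nat),
    (forall n, g (f n) = n) /\ (forall x, f (g x) = x).

Definition is_ideal (X : Type) (I : pset (pset X)) : Prop :=
  (forall A B : pset X, I A -> (forall x, B x -> A x) -> I B) /\
  (forall A B : pset X, I A -> I B -> I (fun x => A x \/ B x)) /\
  (forall A : pset X, finite_set A -> I A) /\
  ~ I (fun _ => True).

Definition restr (X : Type) (I : pset (pset X)) (A : pset X)
  : pset (pset {x : X | A x}) :=
  fun C => exists B, I B /\ forall y : {x : X | A x}, C y <-> B (proj1_sig y).

Definition bijective_map (U V : Type) (f : U -> V) : Prop :=
  exists g : V -> U, (forall u, g (f u) = u) /\ (forall v, f (g v) = v).

Definition katetov_le (X Y : Type) (J : pset (pset Y)) (I : pset (pset X)) : Prop :=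
  exists f : X -> Y, forall B, J B -> I (fun x => B (f x)).

Definition sq_le (U V : Type) (I : pset (pset U)) (J : pset (pset V)) : Prop :=
  exists f : V -> U, bijective_map f /\ forall A, I A -> J (fun v => A (f v)).

Definition Fin2 : pset (pset (nat * nat)) :=
  fun A => finite_set (fun n => ~ finite_set (fun m => A (n, m))).

Definition hereditary_weakP (X : Type) (I : pset (pset X)) : Prop :=
  forall A : pset X, ~ I A -> ~ sq_le Fin2 (restr I A).

(* f : omega^omega -> 2^X is continuous (product topologies) iff each
   coordinate x |-> f g x depends only on a finite initial segment of g *)
Definition baire_continuous (X : Type) (f : (nat -> nat) -> (X -> bool)) : Prop :=
  forall (x : X) (g : nat -> nat), exists N : nat,
    forall h : nat -> nat, (forall k, k < N -> h k = g k) -> f h x = f g x.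

Definition analytic (X : Type) (S : pset (X -> bool)) : Prop :=
  (forall g, ~ S g) \/
  exists f : (nat -> nat) -> (X -> bool), baire_continuous f /\
    forall g, S g <-> exists h, f h = g.

Definition coanalytic (X : Type) (S : pset (X -> bool)) : Prop :=
  analytic (fun g => ~ S g).

Definition coanalytic_ideal (X : Type) (I : pset (pset X)) : Prop :=
  coanalytic (fun g : X -> bool => I (fun x => g x = true)).

Definition hausdorff (P : Type) (opn : pset (pset P)) : Prop :=
  forall p q : P, p <> q -> exists U V, opn U /\ opn V /\ U p /\ V q /\
    forall r, ~ (U r /\ V r).

Definition converges_on (P X : Type) (opn : pset (pset P)) (s : X -> P)
  (A : pset X) (L : P) : Prop :=
  forall U, opn U -> U L -> finite_set (fun n => A n /\ ~ U (s n)).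

Definition FinBW (P X : Type) (opn : pset (pset P)) (I : pset (pset X)) : Prop :=
  hausdorff opn /\
  forall s : X -> P, exists A : pset X, ~ I A /\ exists L, converges_on opn s A L.

Definition ext_eq (X : Type) (A B : pset X) : Prop := forall x, A x <-> B x.

Definition mrowka_family (Ad : pset (pset nat)) : Prop :=
  (~ exists l : list (pset nat), forall A, Ad A -> exists B, In B l /\ ext_eq A B) /\
  (forall A, Ad A -> ~ finite_set A) /\
  (forall A B, Ad A -> Ad B -> ~ ext_eq A B -> finite_set (fun n => A n /\ B n)).

Inductive mpoint (Ad : pset (pset nat)) : Type :=
| Pnat : nat -> mpoint Ad
| Pad : {A : pset nat | Ad A} -> mpoint Ad
| Pinf : mpoint Ad.
Arguments Pnat {Ad}.
Arguments Pad {Ad}.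
Arguments Pinf {Ad}.

Definition mrowka_basic (Ad : pset (pset nat)) (p : mpoint Ad) (U : pset (mpoint Ad))
  : Prop :=
  match p with
  | Pnat n => forall q, U q <-> q = Pnat n
  | Pad a => exists F : pset nat, finite_set F /\
      forall q, U q <-> (q = Pad a \/
                         exists m, q = Pnat m /\ proj1_sig a m /\ ~ F m)
  | Pinf => exists (F : pset nat) (G : pset {A : pset nat | Ad A}),
      finite_set F /\ finite_set G /\
      forall q, U q <-> match q with
                        | Pinf => True
                        | Pad b => ~ G b
                        | Pnat m => ~ F m /\ ~ (exists b, G b /\ proj1_sig b m)
                        end
  end.

Definition mrowka_open (Ad : pset (pset nat)) : pset (pset (mpoint Ad)) :=
  fun U => forall p, U p -> exists V, mrowka_basic p V /\ forall q, V q -> U q.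

Definition is_partial_order (P : Type) (le : P -> P -> Prop) : Prop :=
  (forall p, le p p) /\ (forall p q r, le p q -> le q r -> le p r) /\
  (forall p q, le p q -> le q p -> p = q).

Definition centered (P : Type) (le : P -> P -> Prop) (C : pset P) : Prop :=
  forall l : list P, (forall p, In p l -> C p) ->
    exists r, forall p, In p l -> le r p.

Definition sigma_centered (P : Type) (le : P -> P -> Prop) : Prop :=
  exists C : nat -> pset P, (forall n, centered le (C n)) /\
    forall p, exists n, C n p.

Definition dense (P : Type) (le : P -> P -> Prop) (D : pset P) : Prop :=
  forall p, exists q, D q /\ le q p.

Definition is_filter (P : Type) (le : P -> P -> Prop) (G : pset P) : Prop :=
  (exists p, G p) /\
  (forall p q, G p -> le p q -> G q) /\
  (forall p q, G p -> G q -> exists r, G r /\ le r p /\ le r q).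

Definition lt_continuum (K : Type) : Prop :=
  (exists f : K -> (nat -> bool), forall a b, f a = f b -> a = b) /\
  ~ (exists g : (nat -> bool) -> K, forall a b, g a = g b -> a = b).

Definition MA_sigma_centered : Prop :=
  forall (P : Type) (le : P -> P -> Prop), inhabited P ->
    is_partial_order le -> sigma_centered le ->
    forall (K : Type) (D : K -> pset P), lt_continuum K ->
      (forall k, dense le (D k)) ->
      exists G, is_filter le G /\ forall k, exists p, G p /\ D k p.

(* Main.v *)
(** A sequence in a Mrówka space which is [I']-positively often outside [nat] has a
    positive subsequence which is constant or tends to infinity, by the weak P
    property. So it suffices to build an almost disjoint family [Ad] inside [J] such
    that every [f : nat -> nat] whose fibres are in [I'] has an [A] in [Ad] with
    [f^-1 A] positive: then a positive subsequence of [f] tends to [A]. Applied to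
    the enumerations of infinite sets, the same property shows that no infinite
    subset of [nat] tends to infinity, so the identity sequence witnesses the failure
    for [J].

    [Ad] is built by recursion along the continuum. If no earlier [A] serves [f],
    take [B] in [J] with [f^-1 B] positive ([J] is not Katetov below [I']) and add
    the image under [f] of a positive [Z] inside [f^-1 B] which has finite
    intersection with the fewer than continuum many sets [f^-1 A]. To get such a [Z],
    consider the game in which player I plays sets in [I'] and player II plays finite
    sets avoiding them together with a code of a positive set covered by their union.
    It is closed for II, and the weak P property excludes a winning strategy of I.
    Hence II has a tree of winning positions, and forcing through this tree is
    sigma-centered because there are only countably many positions. *)

From Stdlib Require Import List Lia Arith Wellfounded Cantor.
From Stdlib Require Import Classical ClassicalEpsilon.
From Stdlib Require Import FunctionalExtensionality PropExtensionality ProofIrrelevance.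
From mathcomp Require eqtype boolp wochoice.
Require Import Defs.
Import ListNotations.
Set Implicit Arguments.

Lemma choice (U V : Type) (R : U -> V -> Prop) :
  (forall u, exists v, R u v) -> exists f : U -> V, forall u, R u (f u).
Proof.
  intro h. exists (fun u => proj1_sig (constructive_indefinite_description _ (h u))).
  intro u. apply proj2_sig.
Qed.

(** * Enumerations along the continuum *)

Section WellOrdering.
Import boolp.

(** The principle supplies a relation with a unique least element in every nonempty set. Singletons
    give reflexivity and pairs antisymmetry, so the negated converse is trichotomous; it is well
    founded because a least inaccessible point would be accessible. *)
Lemma well_ordering (T : Type) :
  exists R : T -> T -> Prop,
    well_founded R /\ (forall x y, R x y \/ x = y \/ R y x).
Proof.
  destruct (wochoice.well_ordering_principle
    (eqtype.Equality.clone (boolp.classicType T) _)) as [R HR].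
  assert (min : forall A : T -> Prop, (exists x, A x) ->
     exists z, A z /\ (forall x, A x -> R z x = true) /\
       forall z', A z' -> (forall x, A x -> R z' x = true) -> z = z').
  { intros A [x Ax].
    set (B := fun x : T => if excluded_middle_informative (A x) then true else false).
    assert (hB : forall x, B x = true <-> A x).
    { intro y; unfold B; destruct (excluded_middle_informative (A y)); split; auto; discriminate. }
    destruct (HR B) as [z [[Bz lz] uz]].
    - exists x. apply hB; exact Ax.
    - exists z. split; [apply hB; exact Bz|]. split.
      + intros y Ay. apply lz. apply hB; exact Ay.
      + intros z' Az' lz'. apply uz. split; [apply hB; exact Az'|].
        intros y By. apply lz'. apply hB; exact By. }
  assert (refl : forall x, R x x = true).
  { intro x. destruct (min (eq x)) as [z [<- [hz _]]]; [now exists x | now apply hz]. }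
  assert (anti : forall x y, R x y = true -> R y x = true -> x = y).
  { intros x y hxy hyx. destruct (min (fun t => t = x \/ t = y)) as [z [_ [_ uz]]].
    - exists x; now left.
    - transitivity z; [symmetry|]; apply uz; auto; intros t [-> | ->]; auto. }
  assert (ext : forall x y, R x y = true \/ R y x = true).
  { intros x y. destruct (min (fun t => t = x \/ t = y)) as [z [[-> | ->] [hz _]]].
    - exists x; now left.
    - left; apply hz; now right.
    - right; apply hz; now left. }
  exists (fun x y => R y x <> true). split.
  - intro x. apply NNPP. intro hx.
    destruct (min (fun t => ~ Acc (fun x y => R y x <> true) t)) as [z [hz [lz _]]].
    + now exists x.
    + apply hz. constructor. intros y hy. apply NNPP. intro ny. now apply hy, lz.
  - intros x y.
    destruct (Classical_Prop.classic (R x y = true)), (Classical_Prop.classic (R y x = true)); auto.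
Qed.

End WellOrdering.

Definition injective (U V : Type) (f : U -> V) : Prop :=
  forall a b, f a = f b -> a = b.

Lemma cancel_injective (U V : Type) (f : U -> V) (g : V -> U) :
  (forall u, g (f u) = u) -> injective f.
Proof. intros h a b e. rewrite <- (h a), <- (h b). now f_equal. Qed.

Lemma surjection_of_injection (U V : Type) (j : U -> V) (u0 : U) :
  injective j -> exists e : V -> U, forall u, exists v, e v = u.
Proof.
  intro hj.
  destruct (choice (fun v u => (exists u', j u' = v) -> j u = v)) as [e he].
  - intro v. destruct (classic (exists u, j u = v)) as [[u hu] | h].
    + now exists u.
    + now exists u0.
  - exists e. intro u. exists (j u). apply hj, he. now exists u.
Qed.

Lemma proj1_sig_injective (X : Type) (Q : X -> Prop) :
  injective (fun a : {x | Q x} => proj1_sig a).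
Proof.
  intros a b. exact (eq_sig_hprop (fun _ => proof_irrelevance _) a b).
Qed.

Lemma cantor_diagonal (g : (nat -> bool) -> nat) : ~ injective g.
Proof.
  intro hg. destruct (surjection_of_injection (fun _ => true) hg) as [e he].
  destruct (he (fun n => negb (e n n))) as [n hn].
  apply (f_equal (fun s => s n)) in hn. now destruct (e n n).
Qed.

(** Adds room for the countably many dense sets that make a generic branch infinite. Split a real
    into a pair [x], [y]: either some [y] sends all pairs into [K], which injects the reals into
    [K], or every [y] has an [x] with value in [nat], which injects them into [nat]. *)
Lemma lt_continuum_add_nat (K : Type) : lt_continuum K -> lt_continuum (nat + K).
Proof.
  intros [[f hf] hK]. split.
  - exists (fun a n => match a, n with
                       | inl m, 0 => false | inl m, S k => Nat.eqb m k
                       | inr b, 0 => true | inr b, S k => f b k end).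
    intros [m|a] [m'|b] h.
    + apply (f_equal (fun s => s (S m))) in h. rewrite Nat.eqb_refl in h.
      symmetry in h. apply Nat.eqb_eq in h. now subst.
    + now apply (f_equal (fun s => s 0)) in h.
    + now apply (f_equal (fun s => s 0)) in h.
    + f_equal. apply hf. extensionality n. exact (f_equal (fun s => s (S n)) h).
  - intros [g hg].
    set (pair := fun (x y : nat -> bool) n =>
      if Nat.even n then x (Nat.div2 n) else y (Nat.div2 n)).
    assert (hl : forall x y n, pair x y (2 * n) = x n).
    { intros x y n. unfold pair. now rewrite Nat.even_mul, Nat.div2_double. }
    assert (hr : forall x y n, pair x y (S (2 * n)) = y n).
    { intros x y n. unfold pair.
      now rewrite Nat.even_succ, Nat.odd_mul, Nat.div2_succ_double. }
    destruct (classic (exists y, forall x, exists b, g (pair x y) = inr b)) as [[y hy] | hn].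
    + destruct (choice _ hy) as [g' hg']. apply hK. exists g'. intros x x' h.
      extensionality n. rewrite <- (hl x y n), <- (hl x' y n).
      now rewrite (hg (pair x y) (pair x' y)) by now rewrite !hg', h.
    + destruct (choice (fun y n => exists x, g (pair x y) = inl n)) as [g' hg'].
      * intro y. apply NNPP. intro h. apply hn. exists y. intro x.
        destruct (g (pair x y)) as [n|b] eqn:E; [|now exists b].
        exfalso; apply h. now exists n, x.
      * apply (@cantor_diagonal g'). intros y y' h.
        destruct (hg' y) as [x hx], (hg' y') as [x' hx'].
        extensionality n. rewrite <- (hr x y n), <- (hr x' y' n).
        now rewrite (hg (pair x y) (pair x' y')) by now rewrite hx, hx', h.
Qed.

Lemma continuum_enumeration :
  exists (L : Type) (lt : L -> L -> Prop) (e : L -> nat -> nat),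
    well_founded lt /\ (forall a b, lt a b \/ a = b \/ lt b a) /\
    (forall f, exists a, e a = f) /\ (forall a, lt_continuum {b | lt b a}).
Proof.
  destruct (well_ordering (nat -> bool)) as [R [wfR totR]].
  pose (big := fun s => exists g : (nat -> bool) -> {t | R t s}, injective g).
  (* [Q] is the shortest initial segment into which the reals inject, or everything if no segment
     below a point is that big. *)
  assert (hQ : exists Q : (nat -> bool) -> Prop,
    (exists j : (nat -> bool) -> {t | Q t}, injective j) /\ forall a, Q a -> ~ big a).
  { destruct (classic (exists s, big s)) as [[s hs] | hn].
    - induction s as [s IH] using (well_founded_ind wfR).
      destruct (classic (exists t, R t s /\ big t)) as [[t [hts ht]] | hmin].
      + exact (IH t hts ht).
      + exists (fun t => R t s). split; [exact hs|].
        intros a ha hb. apply hmin. now exists a.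
    - exists (fun _ => True). split.
      + exists (fun t => exist _ t Logic.I). intros a b h. now injection h.
      + intros a _ ha. apply hn. now exists a. }
  destruct hQ as [Q [[j hj] hQ]].
  (* Characteristic functions of graphs embed the Baire space into the Cantor space. *)
  pose (graph := fun (f : nat -> nat) n => let (a, b) := Cantor.of_nat n in Nat.eqb (f a) b).
  assert (hgraph : injective graph).
  { intros f f' h. extensionality n.
    apply (f_equal (fun s => s (Cantor.to_nat (n, f n)))) in h. unfold graph in h.
    rewrite Cantor.cancel_of_to, Nat.eqb_refl in h.
    symmetry in h. now apply Nat.eqb_eq in h. }
  destruct (@surjection_of_injection _ _ (fun f => j (graph f)) (fun _ => 0)) as [e he].
  { intros f f' h. now apply hgraph, hj. }
  exists {t | Q t}, (fun a b => R (proj1_sig a) (proj1_sig b)), e.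
  split; [|split; [|split]].
  - apply wf_inverse_image. exact wfR.
  - intros a b. destruct (totR (proj1_sig a) (proj1_sig b)) as [h | [h | h]]; auto.
    right; left. now apply proj1_sig_injective.
  - exact he.
  - intros a. split.
    + exists (fun b => proj1_sig (proj1_sig b)).
      intros b c h. now apply proj1_sig_injective, proj1_sig_injective.
    + intros [g hg]. apply (hQ (proj1_sig a) (proj2_sig a)).
      exists (fun s => exist _ (proj1_sig (proj1_sig (g s))) (proj2_sig (g s))).
      intros s s' h. apply hg. injection h. intro h'.
      now apply proj1_sig_injective, proj1_sig_injective.
Qed.

(** * Finite sets and ideals *)

Section FiniteSets.
Variable X : Type.
Implicit Types A B : pset X.

Lemma finite_set_subset A B :
  finite_set B -> (forall x, A x -> B x) -> finite_set A.
Proof. intros [l hl] h. exists l. auto. Qed.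

Lemma finite_set_union A B :
  finite_set A -> finite_set B -> finite_set (fun x => A x \/ B x).
Proof.
  intros [l hl] [l' hl']. exists (l ++ l'). intros x [h | h]; apply in_or_app; auto.
Qed.

Lemma finite_set_list_union (U : Type) (F : U -> pset X) (l : list U) :
  (forall u, In u l -> finite_set (F u)) ->
  finite_set (fun x => exists u, In u l /\ F u x).
Proof.
  induction l as [|u l IH]; intro h.
  - exists []. now intros x [u [[] _]].
  - apply finite_set_subset with (fun x => F u x \/ exists v, In v l /\ F v x).
    + apply finite_set_union; [apply h; now left|].
      apply IH. intros v hv. apply h; now right.
    + intros x [v [[-> | hv] hx]]; [now left | right; now exists v].
Qed.

Lemma finite_set_levels B (lev : X -> nat) (n : nat) :
  (forall m, finite_set (fun x => B x /\ lev x = m)) ->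
  finite_set (fun x => B x /\ lev x <= n).
Proof.
  intro h. apply finite_set_subset with
    (fun x => exists m, In m (seq 0 (S n)) /\ (B x /\ lev x = m)).
  - apply finite_set_list_union. auto.
  - intros x [hB hx]. exists (lev x). split; [apply in_seq; lia | auto].
Qed.

Lemma finite_set_preimage (U : Type) (f : X -> U) (S : pset U) B :
  finite_set S -> (forall x, B x -> S (f x)) ->
  (forall x y, B x -> B y -> f x = f y -> x = y) -> finite_set B.
Proof.
  intros [l hl] hS hinj.
  apply finite_set_subset with (fun x => exists u, In u l /\ (B x /\ f x = u)).
  - apply finite_set_list_union. intros u _.
    destruct (classic (exists x, B x /\ f x = u)) as [[x [hx hu]] | hn].
    + exists [x]. intros y [hy hyu]. left. apply hinj; congruence.
    + exists []. intros y hy. apply hn. now exists y.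
  - intros x hx. exists (f x). auto.
Qed.

End FiniteSets.

Lemma finite_set_image (X U : Type) (f : X -> U) (B : pset X) :
  finite_set B -> finite_set (fun u => exists x, B x /\ f x = u).
Proof.
  intros [l hl]. exists (map f l). intros u [x [hx <-]]. apply in_map; auto.
Qed.

Lemma finite_set_nat (A : pset nat) :
  finite_set A <-> exists N, forall x, A x -> x < N.
Proof.
  split.
  - intros [l hl]. exists (S (list_max l)). intros x hx.
    assert (h := proj1 (list_max_le l (list_max l)) (le_n _)).
    rewrite Forall_forall in h. specialize (h x (hl x hx)). lia.
  - intros [N hN]. exists (seq 0 N). intros x hx. apply in_seq. specialize (hN x hx). lia.
Qed.

Lemma infinite_nat (A : pset nat) :
  ~ finite_set A -> forall N, exists x, A x /\ N <= x.
Proof.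
  intros h N. apply NNPP. intro hn. apply h, finite_set_nat. exists N.
  intros x hx. apply NNPP. intro hlt. apply hn. exists x. split; [exact hx | lia].
Qed.

Section Ideals.
Variables (X : Type) (I : pset (pset X)).
Hypothesis hI : is_ideal I.

Lemma ideal_subset (A B : pset X) : I A -> (forall x, B x -> A x) -> I B.
Proof. apply hI. Qed.

Lemma ideal_union (A B : pset X) : I A -> I B -> I (fun x => A x \/ B x).
Proof. apply hI. Qed.

Lemma ideal_finite (A : pset X) : finite_set A -> I A.
Proof. apply hI. Qed.

Lemma ideal_list_union (U : Type) (F : U -> pset X) (l : list U) :
  (forall u, In u l -> I (F u)) -> I (fun x => exists u, In u l /\ F u x).
Proof.
  induction l as [|u l IH]; intro h.
  - apply ideal_finite. exists []. now intros x [u [[] _]].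
  - apply ideal_subset with (fun x => F u x \/ exists v, In v l /\ F v x).
    + apply ideal_union; [apply h; now left|].
      apply IH. intros v hv. apply h; now right.
    + intros x [v [[-> | hv] hx]]; [now left | right; now exists v].
Qed.

Lemma ideal_levels (A : pset X) (lev : X -> nat) (n : nat) :
  (forall m, I (fun x => A x /\ lev x = m)) -> I (fun x => A x /\ lev x <= n).
Proof.
  intro h. apply ideal_subset with
    (fun x => exists m, In m (seq 0 (S n)) /\ (A x /\ lev x = m)).
  - apply ideal_list_union. auto.
  - intros x [hA hx]. exists (lev x). split; [apply in_seq; lia | auto].
Qed.

Lemma positive_diff (A B : pset X) : ~ I A -> I B -> ~ I (fun x => A x /\ ~ B x).
Proof.
  intros hA hB h. apply hA.
  apply ideal_subset with (fun x => (A x /\ ~ B x) \/ B x).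
  - now apply ideal_union.
  - intros x hx. destruct (classic (B x)); auto.
Qed.

End Ideals.

(** * The weak P property *)

Section Rank.
Implicit Type P : pset nat.

(** Counts the elements of [P] below [x]; on an infinite [P] this inverts the increasing
    enumeration. *)
Fixpoint rank P (x : nat) : nat :=
  match x with
  | 0 => 0
  | S y => if excluded_middle_informative (P y) then S (rank P y) else rank P y
  end.

Lemma rank_monotone P x y : x <= y -> rank P x <= rank P y.
Proof.
  induction 1 as [|y _ IH]; [auto|]. simpl.
  destruct (excluded_middle_informative (P y)); lia.
Qed.

Lemma rank_strict P x y : P x -> x < y -> rank P x < rank P y.
Proof.
  intros hx hxy. apply Nat.lt_le_trans with (rank P (S x)).
  - simpl. destruct (excluded_middle_informative (P x)); [lia | easy].
  - now apply rank_monotone.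
Qed.

Lemma rank_attained P y n : n < rank P y -> exists x, P x /\ rank P x = n.
Proof.
  induction y as [|y IH]; simpl; [lia|].
  destruct (excluded_middle_informative (P y)) as [h|h]; [|exact IH].
  intro hn. destruct (Nat.eq_dec n (rank P y)) as [->|hne]; [now exists y|].
  apply IH. lia.
Qed.

Lemma rank_surjective P n : ~ finite_set P -> exists x, P x /\ rank P x = n.
Proof.
  intro hP. assert (h : exists y, n < rank P y);
    [|destruct h as [y hy]; now apply rank_attained with y].
  induction n as [|n [y IH]].
  - destruct (infinite_nat hP 0) as [x [hx _]]. exists (S x).
    assert (h := rank_strict P hx (Nat.lt_succ_diag_r x)). lia.
  - destruct (infinite_nat hP y) as [x [hx hyx]]. exists (S x).
    assert (h := rank_strict P hx (Nat.lt_succ_diag_r x)).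
    assert (h' := rank_monotone P hyx). lia.
Qed.

End Rank.

Definition diagonalizable (X : Type) (I : pset (pset X)) : Prop :=
  forall (A : pset X) (E : nat -> pset X), ~ I A -> (forall n, I (E n)) ->
    exists Z, (forall x, Z x -> A x) /\ ~ I Z /\
      forall n, finite_set (fun x => Z x /\ E n x).

(* If [A] and [E] have no diagonal set, split [A] into the levels of the [E n]
   and regroup consecutive levels into infinite columns; a set which is finite in
   every column is then in [I], so the columns give a copy of [Fin2] in [I|A]. *)
Lemma hereditary_weakP_diagonalizable (X : Type) (I : pset (pset X)) :
  countably_infinite X -> is_ideal I -> hereditary_weakP I -> diagonalizable I.
Proof.
  intros [f [g [hgf hfg]]] hI hW A E hA hE. apply NNPP. intro hno.
  assert (hsmall : forall Z, (forall x, Z x -> A x) ->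
    (forall n, finite_set (fun x => Z x /\ E n x)) -> I Z).
  { intros Z hZ hfin. apply NNPP. intro hn. apply hno. now exists Z. }
  (* The level of [x] is one more than the least [n] with [E n x], and 0 if there is none. Thus
     [E n] meets only the levels 1 to [S n]. *)
  destruct (choice (fun x m => (m = 0 /\ forall n, ~ E n x) \/
      exists n, m = S n /\ E n x /\ forall k, k < n -> ~ E k x)) as [lev hlev].
  { intro x. destruct (classic (exists n, E n x)) as [[n hn] | hn].
    - assert (hm : exists m, E m x /\ forall k, k < m -> ~ E k x).
      { induction n as [n IH] using lt_wf_ind.
        destruct (classic (exists k, k < n /\ E k x)) as [[k [hk hx]] | hk].
        - exact (IH k hk hx).
        - exists n. split; [exact hn|]. intros k hkn hx. apply hk. now exists k. }
      destruct hm as [m [hm hmin]]. exists (S m). right. now exists m.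
    - exists 0. left. split; [auto|]. intros n h. apply hn. now exists n. }
  assert (hlevI : forall m, I (fun x => A x /\ lev x = m)).
  { intros [|m].
    - apply hsmall; [now intros x [h _]|]. intro n. exists [].
      intros x [[_ h0] hx]. destruct (hlev x) as [[_ h] | [k [h _]]]; [|congruence].
      now apply (h n).
    - apply ideal_subset with (E m); auto. intros x [_ hx].
      destruct (hlev x) as [[h _] | [k [h [hk _]]]]; congruence. }
  assert (hthin : forall B, (forall x, B x -> A x) ->
    (forall m, finite_set (fun x => B x /\ lev x = m)) -> I B).
  { intros B hBA hB. apply hsmall; [exact hBA|]. intro n.
    apply finite_set_subset with (fun x => B x /\ lev x <= S n).
    - now apply finite_set_levels.
    - intros x [hx hEx]. split; [exact hx|].
      destruct (hlev x) as [[h _] | [k [h [_ hk]]]]; [lia|].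
      apply NNPP. intro hc. apply (hk n); [lia | exact hEx]. }
  (* The infinite levels. Were there only finitely many, [A] would consist of finitely many levels
     and a set finite on each level, hence lie in [I]. *)
  set (Q := fun m => ~ finite_set (fun x => A x /\ lev x = m)).
  assert (hQ : ~ finite_set Q).
  { intro hfin. apply finite_set_nat in hfin. destruct hfin as [N hN]. apply hA.
    apply (ideal_subset hI) with (fun x => (A x /\ lev x <= N) \/ (A x /\ N < lev x)).
    - apply (ideal_union hI); [now apply (ideal_levels hI)|].
      apply hthin; [now intros x [h _]|]. intro m.
      destruct (classic (Q m)) as [hm | hm].
      + exists []. intros x [[_ h] <-]. specialize (hN _ hm). lia.
      + apply NNPP in hm. eapply finite_set_subset; [exact hm | tauto].
    - intros x hx. destruct (le_lt_dec (lev x) N); auto. }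
  (* The number of infinite levels strictly below that of [x]: a column is a block of consecutive
     levels of which only the last is infinite. *)
  set (col := fun x => rank Q (lev x)).
  assert (hcol : forall N, exists q, Q q /\ rank Q q = N /\
      forall x, col x <= N -> lev x <= q).
  { intro N. destruct (rank_surjective N hQ) as [q [hq hqN]]. exists q.
    split; [exact hq|]. split; [exact hqN|]. intros x hx. apply NNPP. intro hc.
    assert (h := rank_strict Q hq (proj1 (Nat.nle_gt _ _) hc)).
    unfold col in hx. lia. }
  set (column := fun j n => exists y, g y = n /\ A y /\ col y = j).
  assert (hcolumn : forall j, ~ finite_set (column j)).
  { intros j hfin. destruct (hcol j) as [q [hq [hqj _]]]. apply hq.
    apply (finite_set_preimage g) with (column j); [exact hfin | |].
    - intros x [hx hxq]. exists x. unfold col. now rewrite hxq.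
    - intros x y _ _ h. rewrite <- (hfg x), <- (hfg y). now f_equal. }
  set (row := fun x => rank (column (col x)) (g x)).
  assert (hinj : forall x y, A x -> A y -> col x = col y -> row x = row y -> x = y).
  { intros x y hx hy hc hr. unfold row in hr. rewrite hc in hr.
    rewrite <- (hfg x), <- (hfg y). f_equal.
    destruct (lt_eq_lt_dec (g x) (g y)) as [[h | h] | h]; [exfalso | exact h | exfalso].
    - apply (rank_strict (column (col y))) in h; [lia | now exists x].
    - apply (rank_strict (column (col y))) in h; [lia | now exists y]. }
  apply (hW A hA).
  exists (fun v => (col (proj1_sig v), row (proj1_sig v))). split.
  - destruct (choice (fun (jn : nat * nat) (v : {x | A x}) =>
      (col (proj1_sig v), row (proj1_sig v)) = jn)) as [inv hinv].
    { intros [j n]. destruct (rank_surjective n (hcolumn j)) as [x [[y [<- [hy <-]]] hx]].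
      exists (exist _ y hy). simpl. unfold row. now rewrite hx. }
    exists inv. split; [|exact hinv].
    intro v. apply proj1_sig_injective. assert (h := hinv (col (proj1_sig v), row (proj1_sig v))).
    injection h as h1 h2. apply hinj; auto; apply proj2_sig.
  - intros S hS. exists (fun x => A x /\ S (col x, row x)). split.
    (* The columns up to [N] reach finitely many levels only; beyond them [S] is finite in each
       column, hence on each level. *)
    + apply finite_set_nat in hS. destruct hS as [N hN].
      destruct (hcol N) as [q [_ [_ hq]]].
      apply (ideal_subset hI) with (fun x =>
        (A x /\ lev x <= q) \/ (A x /\ S (col x, row x) /\ N < col x)).
      * apply (ideal_union hI); [now apply (ideal_levels hI)|].
        apply hthin; [now intros x [h _]|]. intro m.
        destruct (le_lt_dec (rank Q m) N) as [hm | hm].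
        -- exists []. intros x [[_ [_ h]] <-]. unfold col in h. lia.
        -- apply (finite_set_preimage row) with (fun n => S (rank Q m, n)).
           ++ apply NNPP. intro h. apply hN in h. lia.
           ++ intros x [[_ [h _]] <-]. exact h.
           ++ intros x y [[hx _] hxm] [[hy _] hym]. apply hinj; auto.
              unfold col. now rewrite hxm, hym.
      * intros x [hx hS]. destruct (le_lt_dec (col x) N); auto.
    + intros [x hx]. simpl. tauto.
Qed.

(** * The covering game *)

Fixpoint fast_seq (g : nat -> nat) (n : nat) : nat :=
  match n with
  | 0 => 0
  | S m => S (max (g (fast_seq g m)) (fast_seq g m))
  end.

Lemma fast_seq_monotone g m n : m <= n -> fast_seq g m <= fast_seq g n.
Proof. induction 1; simpl; lia. Qed.

Lemma fast_seq_ge g n : n <= fast_seq g n.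
Proof. induction n; simpl; lia. Qed.

Lemma fast_seq_block g x n : x < fast_seq g n ->
  exists m, fast_seq g m <= x < fast_seq g (S m).
Proof.
  induction n as [|n IH]; [simpl; lia|]. intro hx.
  destruct (le_lt_dec (fast_seq g n) x) as [h | h]; [now exists n | auto].
Qed.

(* Cut at a fast sequence: the even or the odd blocks of [Z] are positive. *)
Lemma positive_subset_with_gaps (K : pset (pset nat)) (Z : pset nat) (g : nat -> nat) :
  is_ideal K -> ~ K Z ->
  exists Z0, (forall x, Z0 x -> Z x) /\ ~ K Z0 /\ (forall x, Z0 x -> g 0 <= x) /\
    forall N, exists b, N <= b /\ forall x, Z0 x -> b <= x -> g b <= x.
Proof.
  intros hK hZ. set (a := fast_seq g).
  set (half := fun r x => Z x /\ exists n, a (2 * n + r) <= x < a (S (2 * n + r))).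
  assert (hr : exists r, ~ K (half r)).
  { apply NNPP. intro hn. apply hZ.
    apply (ideal_subset hK) with (fun x => half 0 x \/ half 1 x).
    - apply (ideal_union hK); apply NNPP; intro h; apply hn; eauto.
    - intros x hx. destruct (@fast_seq_block g x (S x)) as [m hm].
      { assert (h := fast_seq_ge g (S x)). lia. }
      destruct (Nat.Even_or_Odd m) as [[n ->] | [n ->]].
      + left. split; [exact hx|]. exists n. now rewrite Nat.add_0_r.
      + right. split; [exact hx|]. now exists n. }
  destruct hr as [r hr].
  exists (fun x => half r x /\ ~ x < g 0). split; [|split; [|split]].
  - now intros x [[h _] _].
  - apply (positive_diff hK); [exact hr|]. apply (ideal_finite hK).
    apply finite_set_nat. now exists (g 0).
  - intros x [_ h]. lia.
  (* This [b] starts a discarded block. The next kept block starts where that one ends, beyond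
     [g b]. *)
  - intro N. exists (a (S (2 * N + r))). split.
    + assert (h := fast_seq_ge g (S (2 * N + r))). unfold a. lia.
    + intros x [[_ [n hn]] _] hx.
      assert (hlt : N < n).
      { apply NNPP. intro hc. assert (h : S (2 * n + r) <= S (2 * N + r)) by lia.
        apply (fast_seq_monotone g) in h. fold a in h. lia. }
      assert (h : S (S (2 * N + r)) <= 2 * n + r) by lia.
      apply (fast_seq_monotone g) in h. unfold a in *. cbn [fast_seq] in *. lia.
Qed.

Fixpoint bounded_lists (U : Type) (l : list U) (n : nat) : list (list U) :=
  match n with
  | 0 => [[]]
  | S m => [] :: flat_map (fun u => map (cons u) (bounded_lists l m)) l
  end.

Lemma in_bounded_lists (U : Type) (l p : list U) (n : nat) :
  length p <= n -> (forall u, In u p -> In u l) -> In p (bounded_lists l n).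
Proof.
  revert p. induction n as [|n IH]; intros [|u p] hn hp; simpl in *; auto; try lia.
  right. apply in_flat_map. exists u. split; [auto|]. apply in_map, IH; [lia | auto].
Qed.

Section CoveringGame.

(* Player I plays sets [E] in [K], player II answers with a finite subset of [D]
   disjoint from [E] and one more digit of a real coding a positive set.
   Positions list the moves of II, last move first. *)
Definition move : Type := list nat * nat.

Fixpoint prefix (b : nat -> move) (n : nat) : list move :=
  match n with
  | 0 => []
  | S m => b m :: prefix b m
  end.

Lemma prefix_length b n : length (prefix b n) = n.
Proof. induction n; simpl; auto. Qed.

Lemma in_prefix b n q : In q (prefix b n) <-> exists i, i < n /\ b i = q.
Proof.
  induction n as [|n IH]; simpl.
  - split; [easy | intros [i [h _]]; lia].
  - rewrite IH. split.
    + intros [<- | [i [hi <-]]]; [exists n | exists i]; auto.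
    + intros [i [hi <-]]. destruct (Nat.eq_dec i n) as [->|h]; [now left|].
      right. exists i. split; [lia | auto].
Qed.

Lemma nth_prefix b i n q : i < n -> nth (n - S i) (prefix b n) q = b i.
Proof.
  induction n as [|n IH]; intro h; [lia|].
  destruct (Nat.eq_dec i n) as [->|hne].
  - now rewrite Nat.sub_diag.
  - replace (S n - S i) with (S (n - S i)) by lia. simpl. apply IH. lia.
Qed.

Lemma prefix_agree b b' n i : prefix b n = prefix b' n -> i < n -> b i = b' i.
Proof.
  intros h hi. rewrite <- (nth_prefix b (b 0) hi), <- (nth_prefix b' (b 0) hi). now rewrite h.
Qed.

Variables (K : pset (pset nat)) (c : (nat -> nat) -> nat -> bool) (D : pset nat).
Hypotheses (hK : is_ideal K) (hdiag : diagonalizable K) (hcont : baire_continuous c)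
  (hcode : forall s, ~ K (fun x => s x = true) <-> exists h, c h = s) (hD : ~ K D).

(* Covering [x] by move [x] at the latest makes this a closed condition. *)
Definition covering (b : nat -> move) : Prop :=
  forall x, c (fun i => snd (b i)) x = true -> exists l, l <= x /\ In x (fst (b l)).

(** [E] is a winning strategy of player I from [p]: it answers each position with a set, and no
    covering run through [p] obeys the rules against it from [p] on. *)
Definition lost (p : list move) : Prop :=
  exists E : list move -> pset nat, (forall q, K (E q)) /\
    forall b, covering b -> prefix b (length p) = p ->
      ~ forall i, length p <= i -> forall x, In x (fst (b i)) ->
          D x /\ ~ E (prefix b i) x.

(** If no covering run passes through [p], player I wins by playing empty sets. *)
Lemma not_lost_covering p : ~ lost p -> exists b, covering b /\ prefix b (length p) = p.
Proof.
  intro h. apply NNPP. intro hn. apply h. exists (fun _ _ => False). split.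
  - intros _. apply (ideal_finite hK). now exists [].
  - intros b hb hp _. apply hn. now exists b.
Qed.

(** If every legal reply to [E] were lost, player I could play [E] and then follow a strategy chosen
    for the reply, and so win from [p]. *)
Lemma not_lost_step p E : ~ lost p -> K E ->
  exists q : move, (forall x, In x (fst q) -> D x /\ ~ E x) /\ ~ lost (q :: p).
Proof.
  intros hp hE. apply NNPP. intro hn. apply hp.
  assert (hq : forall q : move, exists Eq : list move -> pset nat, (forall r, K (Eq r)) /\
    ((forall x, In x (fst q) -> D x /\ ~ E x) ->
     forall b, covering b -> prefix b (S (length p)) = q :: p ->
      ~ forall i, S (length p) <= i -> forall x, In x (fst (b i)) ->
          D x /\ ~ Eq (prefix b i) x)).
  { intro q. destruct (classic (forall x, In x (fst q) -> D x /\ ~ E x)) as [h | h].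
    - destruct (NNPP (lost (q :: p))) as [Eq [h1 h2]].
      + intro hl. apply hn. now exists q.
      + exists Eq. split; auto.
    - exists (fun _ _ => False). split; [|tauto].
      intros _. apply (ideal_finite hK). now exists []. }
  destruct (choice _ hq) as [Es hEs].
  (* As positions list the last move first, this index finds the reply made at [p], which selects
     the strategy to continue with. The value at positions shorter than [p] does not matter. *)
  exists (fun r => if Nat.eqb (length r) (length p) then E
                   else Es (nth (length r - S (length p)) r ([], 0)) r).
  split.
  - intro r. destruct (Nat.eqb _ _); [exact hE | apply hEs].
  - intros b hb hbp hav. destruct (hEs (b (length p))) as [_ h].
    apply h with b; simpl; [| exact hb | now rewrite hbp |].
    + intros x hx. destruct (hav (length p) (le_n _) x hx) as [h1 h2].
      rewrite prefix_length, Nat.eqb_refl in h2. auto.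
    + intros i hi x hx. destruct (hav i) with x as [h1 h2]; [lia | exact hx |].
      rewrite prefix_length, nth_prefix in h2 by lia.
      destruct (Nat.eqb_spec i (length p)); [lia | auto].
Qed.

(** The union contains the positive set coded by the digits of [b]. Whether [x] is in that set
    depends on finitely many digits, and it must be covered by move [x]; both can be read off a
    covering run sharing a long prefix with [b]. *)
Lemma not_lost_branch b : (forall N, exists n, N <= n /\ ~ lost (prefix b n)) ->
  ~ K (fun x => exists i, In x (fst (b i))).
Proof.
  intros hb hKb. set (h := fun i => snd (b i)).
  apply (proj2 (hcode (c h))); [now exists h|].
  apply (ideal_subset hK) with (1 := hKb). intros x hx.
  destruct (hcont x h) as [N hN]. destruct (hb (max N (S x))) as [n [hn hl]].
  destruct (not_lost_covering hl) as [b' [hb' hp]]. rewrite prefix_length in hp.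
  destruct (hb' x) as [l [hl' hin]].
  - rewrite <- hx. apply hN. intros k hk. unfold h. f_equal.
    apply prefix_agree with n; [exact hp | lia].
  - exists l. rewrite <- (prefix_agree b' b hp); [exact hin | lia].
Qed.

(* Otherwise a strategy [E] of player I beats II. It uses countably many sets, so
   a positive [Z] meets each of them in a finite set. Playing a subset of [Z] with
   long gaps, II can wait for the digits of its code before each block. *)
Lemma not_lost_nil : ~ lost [].
Proof.
  intros [E [hE hwin]].
  (* The finitely many positions with at most [n] moves, whose finite sets have at most [n] listed
     entries, all entries and digits being below [n]. *)
  set (positions := fun n => bounded_lists
         (list_prod (bounded_lists (seq 0 n) n) (seq 0 n)) n).
  destruct (hdiag (A := D) (fun n x => exists p, In p (positions n) /\ E p x))
    as [Z [hZD [hZ hfin]]];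
    [exact hD | intro n; apply (ideal_list_union hK); auto |].
  destruct (choice _ (fun n => proj1 (finite_set_nat _) (hfin n))) as [g hg].
  destruct (@positive_subset_with_gaps K Z g hK hZ) as [Z0 [hZ0Z [hZ0 [hg0 hgap]]]].
  set (s := fun x => if excluded_middle_informative (Z0 x) then true else false).
  assert (hs : forall x, s x = true <-> Z0 x).
  { intro x. unfold s. destruct (excluded_middle_informative (Z0 x)); split; easy. }
  destruct (proj1 (hcode s)) as [h hh].
  { intro hKs. apply hZ0. apply (ideal_subset hK) with (1 := hKs). apply hs. }
  destruct (choice _ hgap) as [next hnext].
  (* Move [i] of II will be [Z0] between [cut i] and [cut (S i)], with digit [h i]. The lower bounds
     put [prefix b i] into [positions (cut i)], so the answer of [E] meets [Z] below [g (cut i)]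
     only, and the gap after [cut i] keeps the move legal. *)
  set (cut := fix cut i := match i with
    | 0 => 0 | S j => next (max (S (h j)) (S (cut j))) end).
  assert (hcutS : forall i, S (h i) <= cut (S i) /\ S (cut i) <= cut (S i)).
  { intro i. destruct (hnext (max (S (h i)) (S (cut i)))) as [hm _].
    change (cut (S i)) with (next (max (S (h i)) (S (cut i)))). lia. }
  assert (hmono : forall i j, i <= j -> cut i <= cut j).
  { induction 1 as [|j _ IH]; [auto|]. specialize (hcutS j). lia. }
  assert (hge : forall i, i <= cut i).
  { induction i as [|i IH]; [lia|]. specialize (hcutS i). lia. }
  assert (hcutgap : forall i x, Z0 x -> cut i <= x -> g (cut i) <= x).
  { intros [|i] x hx hc; [now apply hg0 | now apply hnext]. }
  set (b := fun i => (filter s (seq (cut i) (cut (S i) - cut i)), h i)).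
  assert (hb : forall i x, In x (fst (b i)) <-> Z0 x /\ cut i <= x < cut (S i)).
  { intros i x. unfold b. cbn [fst]. rewrite filter_In, in_seq, hs.
    specialize (hcutS i). intuition lia. }
  apply hwin with b; [| reflexivity |].
  - intros x hx.
    assert (hx' : Z0 x) by (apply hs; rewrite <- hh; exact hx).
    assert (hl : forall n, x < cut n -> exists l, l < n /\ cut l <= x < cut (S l)).
    { induction n as [|n IH]; [simpl; lia|]. intro hn.
      destruct (le_lt_dec (cut n) x) as [hc | hc].
      - exists n. auto.
      - destruct (IH hc) as [l [h1 h2]]. exists l. auto. }
    destruct (hl (S x)) as [l [h1 h2]]; [specialize (hge (S x)); lia|].
    exists l. split; [lia|]. now apply hb.
  - intros i _ x hx. apply hb in hx. destruct hx as [hx [hx1 hx2]].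
    split; [auto|]. intro hEx.
    assert (hlt : x < g (cut i)); [|specialize (hcutgap i x hx hx1); lia].
    apply hg. split; [auto|]. exists (prefix b i). split; [|exact hEx].
    apply in_bounded_lists; [rewrite prefix_length; apply hge|].
    intros q hq. apply in_prefix in hq. destruct hq as [l [hl <-]].
    assert (hle := hmono (S l) i hl). assert (hS := hcutS l).
    apply in_prod.
    + apply in_bounded_lists.
      * unfold b. etransitivity; [apply filter_length_le|]. rewrite length_seq. lia.
      * intros y hy. apply hb in hy. apply in_seq. lia.
    + apply in_seq. lia.
Qed.

(** All that the forcing needs from the game; [T] consists of the positions not lost for II. *)
Lemma covering_tree :
  exists T : list move -> Prop, T [] /\
    (forall p E, T p -> K E ->
       exists q : move, (forall x, In x (fst q) -> D x /\ ~ E x) /\ T (q :: p)) /\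
    forall b, (forall N, exists n, N <= n /\ T (prefix b n)) ->
      ~ K (fun x => exists i, In x (fst (b i))).
Proof.
  exists (fun p => ~ lost p). split; [exact not_lost_nil | split].
  - intros p E. apply not_lost_step.
  - apply not_lost_branch.
Qed.

End CoveringGame.

(** * Forcing through the tree of positions *)

Fixpoint list_code (U : Type) (f : U -> nat) (l : list U) : nat :=
  match l with
  | [] => 0
  | u :: l' => S (Cantor.to_nat (f u, list_code f l'))
  end.

Lemma to_nat_injective (p q : nat * nat) : Cantor.to_nat p = Cantor.to_nat q -> p = q.
Proof.
  exact (cancel_injective _ _ Cantor.cancel_of_to p q).
Qed.

Lemma list_code_injective (U : Type) (f : U -> nat) :
  injective f -> injective (list_code f).
Proof.
  intros hf l. induction l as [|u l IH]; intros [|v m] h; try easy.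
  apply eq_add_S, to_nat_injective in h. injection h as h1 h2.
  f_equal; [now apply hf | now apply IH].
Qed.

Lemma positions_countable : exists code : list move -> nat, injective code.
Proof.
  exists (list_code (fun q => Cantor.to_nat (list_code (fun n => n) (fst q), snd q))).
  apply list_code_injective. intros [F k] [F' k'] h.
  apply to_nat_injective in h. injection h as h1 ->.
  f_equal. revert h1. apply list_code_injective. now intros a b.
Qed.

Section Diagonalization.
Variables (K : pset (pset nat)) (D : pset nat) (L : Type) (E : L -> pset nat).
Variable T : list move -> Prop.
Hypotheses (MA : MA_sigma_centered) (hK : is_ideal K) (hL : lt_continuum L)
  (hE : forall l, K (E l)) (Tnil : T [])
  (Tstep : forall p E, T p -> K E ->
    exists q : move, (forall x, In x (fst q) -> D x /\ ~ E x) /\ T (q :: p)).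

(** Mathias-style conditions: the stem is a finite part of the branch, and the promise names
    finitely many [E l] that all further moves must avoid. *)
Definition condition : Type :=
  {a : list move * pset L |
    T (fst a) /\ (forall q x, In q (fst a) -> In x (fst q) -> D x) /\ finite_set (snd a)}.

Definition stem (a : condition) : list move := fst (proj1_sig a).
Definition promise (a : condition) : pset L := snd (proj1_sig a).

Definition stronger (a b : condition) : Prop :=
  exists r, stem a = r ++ stem b /\ (forall l, promise b l -> promise a l) /\
    forall q x l, In q r -> In x (fst q) -> promise b l -> ~ E l x.

Lemma stronger_partial_order : is_partial_order stronger.
Proof.
  split; [|split].
  - intro a. exists []. now split; [|split].
  - intros a b d [r [h1 [h2 h3]]] [r' [h1' [h2' h3']]]. exists (r ++ r').
    split; [now rewrite h1, h1', app_assoc|]. split; [auto|].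
    intros q x l hq hx hl. apply in_app_or in hq. destruct hq as [hq | hq].
    + apply (h3 q x l hq hx). auto.
    + now apply (h3' q x l hq hx).
  - intros a b [r [h1 [h2 _]]] [r' [h1' [h2' _]]].
    assert (hr : r = []).
    { apply (f_equal (@length _)) in h1, h1'. rewrite length_app in h1, h1'.
      destruct r; simpl in *; [reflexivity | lia]. }
    subst r. apply proj1_sig_injective.
    unfold stem, promise in *. destruct (proj1_sig a) as [p G], (proj1_sig b) as [p' G'].
    simpl in *. f_equal; [exact h1|].
    extensionality l. apply propositional_extensionality. split; auto.
Qed.

Lemma root_condition : exists a, stem a = [].
Proof.
  unshelve eexists (exist _ ([], fun _ => False) _).
  - split; [exact Tnil|]. split; [easy | now exists []].
  - reflexivity.
Qed.

(** Finitely many conditions with the same stem are bounded by that stem with the union of their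
    promises, and there are countably many stems. *)
Lemma stronger_sigma_centered : sigma_centered stronger.
Proof.
  destruct positions_countable as [code hcode].
  exists (fun n a => code (stem a) = n). split.
  - intros n [|a l] hl.
    + destruct root_condition as [a _]. now exists a.
    + unshelve eexists (exist _ (stem a, fun m => exists b, In b (a :: l) /\ promise b m) _).
      * simpl. destruct (proj2_sig a) as [h1 [h2 _]]. split; [exact h1|]. split; [exact h2|].
        apply (finite_set_list_union (fun b => promise b) (a :: l)).
        intros b _. apply (proj2_sig b).
      * intros b hb. exists []. split; [|split].
        -- simpl. unfold stem at 1. simpl. apply hcode.
           now rewrite (hl a (or_introl eq_refl)), (hl b hb).
        -- intros m hm. now exists b.
        -- easy.
  - intro a. now exists (code (stem a)).
Qed.

(** The union of the promised sets is in [K], so player I may play it; a reply of II within [T]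
    lengthens the stem. *)
Lemma length_dense (n : nat) : dense stronger (fun a => n <= length (stem a)).
Proof.
  intro a. induction n as [|n [b [hb hba]]].
  - exists a. split; [lia | apply stronger_partial_order].
  - destruct (proj2_sig b) as [h1 [h2 [lst h3]]].
    destruct (Tstep (E := fun x => exists l, In l lst /\ E l x) h1) as [q [hq hT]].
    { apply (ideal_list_union hK). auto. }
    unshelve eexists (exist _ (q :: stem b, promise b) _).
    + simpl. split; [exact hT|]. split; [|now exists lst].
      intros r x [<- | hr] hx; [now apply hq | now apply (h2 r x)].
    + split; [unfold stem at 1; simpl; lia|].
      destruct stronger_partial_order as [_ [trans _]]. apply trans with b; [|exact hba].
      exists [q]. split; [reflexivity|]. split; [auto|].
      intros r x l [<- | []] hx hl hEx. apply (proj2 (hq x hx)). exists l. auto.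
Qed.

Lemma promise_dense (l : L) : dense stronger (fun a => promise a l).
Proof.
  intro a. destruct (proj2_sig a) as [h1 [h2 h3]].
  unshelve eexists (exist _ (stem a, fun m => promise a m \/ m = l) _).
  - simpl. split; [exact h1|]. split; [exact h2|].
    apply finite_set_union; [exact h3|]. exists [l]. intros m ->. now left.
  - split; [now right|]. exists []. split; [reflexivity|]. split; [now left | easy].
Qed.

Lemma suffix_unique (U : Type) (r r' s s' : list U) :
  r ++ s = r' ++ s' -> length s = length s' -> s = s'.
Proof.
  intros h hl. assert (hr : length r = length r').
  { apply (f_equal (@length _)) in h. rewrite !length_app in h. lia. }
  revert r' h hr. induction r as [|u r IH]; intros [|v r'] h hr; try easy.
  injection h as _ h. simpl in hr. injection hr as hr. eauto.
Qed.

(** Stems from a filter are compatible, so they are the prefixes of one branch, infinite by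
    [length_dense]. Once [l] is promised, later moves avoid [E l], and only the finitely many points
    of that stem can meet it. *)
Lemma generic_branch :
  exists b, (forall N, exists n, N <= n /\ T (prefix b n)) /\
    (forall x i, In x (fst (b i)) -> D x) /\
    forall l, finite_set (fun x => (exists i, In x (fst (b i))) /\ E l x).
Proof.
  destruct (MA (P := condition) (le := stronger)) with
    (K := (nat + L)%type)
    (D := fun k => match k with inl n => fun a => n <= length (stem a)
                              | inr l => fun a => promise a l end)
    as [G [[_ [_ hdir]] hgen]].
  - destruct root_condition as [a _]. constructor; exact a.
  - exact stronger_partial_order.
  - exact stronger_sigma_centered.
  - now apply lt_continuum_add_nat.
  - intros [n | l]; [apply length_dense | apply promise_dense].
  - destruct (choice (fun n q => exists a r p, G a /\ stem a = r ++ q :: p /\ length p = n))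
      as [b hb].
    { intro n. destruct (hgen (inl (S n))) as [a [ha hn]].
      exists (nth (length (stem a) - S n) (stem a) ([], 0)), a.
      set (k := length (stem a) - S n).
      destruct (nth_split (stem a) ([], 0) (n := k)) as [r [p [h1 h2]]]; [lia|].
      exists r, p. split; [exact ha|]. split; [exact h1|].
      apply (f_equal (@length _)) in h1. rewrite length_app in h1. simpl in h1. lia. }
    assert (hbranch : forall a, G a -> stem a = prefix b (length (stem a))).
    { intros a ha. assert (hs : forall p r, stem a = r ++ p -> p = prefix b (length p)).
      { induction p as [|q p IH]; intros r hr; [reflexivity|]. simpl. f_equal.
        - destruct (hb (length p)) as [a' [r' [p' [ha' [h1 h2]]]]].
          destruct (hdir a a' ha ha') as [d [_ [[t [ht _]] [t' [ht' _]]]]].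
          rewrite ht, hr, h1, !app_assoc in ht'.
          apply suffix_unique in ht'; [congruence | simpl; lia].
        - apply (IH (r ++ [q])). now rewrite <- app_assoc. }
      now apply (hs _ []). }
    assert (hext : forall a i, G a -> exists d, G d /\ stronger d a /\ In (b i) (stem d)).
    { intros a i ha. destruct (hgen (inl (S i))) as [a' [ha' hi]].
      destruct (hdir a a' ha ha') as [d [hd [hda [r [hr _]]]]].
      exists d. split; [exact hd|]. split; [exact hda|].
      rewrite (hbranch d hd). apply in_prefix. exists i. split; [|reflexivity].
      rewrite hr, length_app. lia. }
    exists b. split; [|split].
    + intro N. destruct (hgen (inl N)) as [a [ha hN]]. exists (length (stem a)).
      split; [exact hN|]. rewrite <- (hbranch a ha). apply (proj2_sig a).
    + intros x i hx. destruct (hgen (inl 0)) as [a [ha _]].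
      destruct (hext a i ha) as [d [_ [_ hin]]].
      destruct (proj2_sig d) as [_ [h _]]. exact (h (b i) x hin hx).
    + intro l. destruct (hgen (inr l)) as [a [ha hl]].
      apply finite_set_subset with (fun x => exists q, In q (stem a) /\ In x (fst q)).
      * apply (finite_set_list_union (fun q x => In x (fst q))).
        intros q _. now exists (fst q).
      * intros x [[i hx] hEx]. exists (b i). split; [|exact hx].
        destruct (hext a i ha) as [d [_ [[r [hr [_ hav]]] hin]]].
        rewrite hr in hin. apply in_app_or in hin. destruct hin as [hin | hin]; [|exact hin].
        destruct (hav (b i) x l hin hx hl hEx).
Qed.

End Diagonalization.

(** The whole set is positive, which rules out the empty case of [analytic]. *)
Lemma coanalytic_ideal_code (X : Type) (K : pset (pset X)) :
  is_ideal K -> coanalytic_ideal K ->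
  exists c : (nat -> nat) -> X -> bool, baire_continuous c /\
    forall s, ~ K (fun x => s x = true) <-> exists h, c h = s.
Proof.
  intros hK [hempty | h]; [|exact h].
  exfalso. apply (hempty (fun _ => true)). intro h. apply hK.
  apply (ideal_subset hK) with (1 := h). auto.
Qed.

(** Martin's axiom lifts [diagonalizable] from countably many to fewer than continuum many sets. *)
Lemma diagonalize_below_continuum (K : pset (pset nat)) (D : pset nat)
  (L : Type) (E : L -> pset nat) :
  MA_sigma_centered -> is_ideal K -> coanalytic_ideal K -> diagonalizable K ->
  ~ K D -> lt_continuum L -> (forall l, K (E l)) ->
  exists Z, (forall x, Z x -> D x) /\ ~ K Z /\
    forall l, finite_set (fun x => Z x /\ E l x).
Proof.
  intros MA hK hco hdiag hD hL hE.
  destruct (coanalytic_ideal_code hK hco) as [c [hcont hcode]].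
  destruct (covering_tree D hK hdiag hcont hcode hD) as [T [Tnil [Tstep Tbranch]]].
  destruct (@generic_branch K D L E T MA hK hL hE Tnil Tstep) as [b [hb [hbD hfin]]].
  exists (fun x => exists i, In x (fst (b i))). split; [|split; auto].
  intros x [i hx]. eauto.
Qed.

(** * The almost disjoint family *)

Lemma finite_preimage_in_ideal (K : pset (pset nat)) (f : nat -> nat) (S : pset nat) :
  is_ideal K -> (forall m, K (fun n => f n = m)) -> finite_set S -> K (fun n => S (f n)).
Proof.
  intros hK hf [l hl].
  apply (ideal_subset hK) with (fun n => exists m, In m l /\ f n = m).
  - apply (ideal_list_union hK). auto.
  - intros n hn. exists (f n). auto.
Qed.

Lemma extend_family (K J : pset (pset nat)) (L : Type) (A : L -> pset nat) (f : nat -> nat) :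
  MA_sigma_centered -> is_ideal K -> coanalytic_ideal K -> diagonalizable K ->
  is_ideal J -> ~ katetov_le J K -> lt_continuum L ->
  exists S, J S /\ (forall l, finite_set (fun m => S m /\ A l m)) /\
    ((exists l, ~ K (fun n => A l (f n))) \/ ~ K (fun n => S (f n))).
Proof.
  intros MA hK hco hdiag hJ hJK hL.
  destruct (classic (exists l, ~ K (fun n => A l (f n)))) as [h | h].
  (* An earlier set already serves [f]; the empty set is a dummy, dropped from the final family with
     all finite sets. *)
  - exists (fun _ => False). split; [apply (ideal_finite hJ); now exists []|].
    split; [intro l; now exists [] | now left].
  - assert (hA : forall l, K (fun n => A l (f n))).
    { intro l. apply NNPP. intro hl. apply h. now exists l. }
    assert (hB : exists B, J B /\ ~ K (fun n => B (f n))).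
    { apply NNPP. intro hn. apply hJK. exists f. intros B hB. apply NNPP. intro hBf.
      apply hn. now exists B. }
    destruct hB as [B [hB hBf]].
    destruct (@diagonalize_below_continuum K _ L (fun l n => A l (f n)) MA hK hco hdiag hBf hL hA)
      as [Z [hZ [hZpos hfin]]].
    exists (fun m => exists n, Z n /\ f n = m). split; [|split].
    + apply (ideal_subset hJ) with (1 := hB). intros m [n [hn <-]]. auto.
    + intro l. eapply finite_set_subset; [exact (finite_set_image f (hfin l))|].
      intros m [[n [hn <-]] hm]. now exists n.
    + right. intro hc. apply hZpos. apply (ideal_subset hK) with (1 := hc).
      intros n hn. now exists n.
Qed.

Lemma almost_disjoint_family (K J : pset (pset nat)) :
  MA_sigma_centered -> is_ideal K -> coanalytic_ideal K -> diagonalizable K ->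
  is_ideal J -> ~ katetov_le J K ->
  exists Ad : pset (pset nat),
    (forall A, Ad A -> J A) /\ (forall A, Ad A -> ~ finite_set A) /\
    (forall A B, Ad A -> Ad B -> ~ ext_eq A B -> finite_set (fun n => A n /\ B n)) /\
    forall f, (forall m, K (fun n => f n = m)) -> exists A, Ad A /\ ~ K (fun n => A (f n)).
Proof.
  intros MA hK hco hdiag hJ hJK.
  destruct continuum_enumeration as [L [lt [e [wf [tot [he hL]]]]]].
  assert (hstep : forall a, exists step : ({b | lt b a} -> pset nat) -> pset nat,
    forall A, J (step A) /\ (forall l, finite_set (fun m => step A m /\ A l m)) /\
      ((exists l, ~ K (fun n => A l (e a n))) \/ ~ K (fun n => step A (e a n)))).
  { intro a. apply (choice (fun (A : {b | lt b a} -> pset nat) S => J S /\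
      (forall l, finite_set (fun m => S m /\ A l m)) /\
      ((exists l, ~ K (fun n => A l (e a n))) \/ ~ K (fun n => S (e a n))))).
    intro A. apply extend_family; auto. }
  set (step := fun a => proj1_sig (constructive_indefinite_description _ (hstep a))).
  set (A := Fix wf (fun _ => pset nat)
    (fun a rec => step a (fun b => rec (proj1_sig b) (proj2_sig b)))).
  assert (hA : forall a, J (A a) /\ (forall b, lt b a -> finite_set (fun m => A a m /\ A b m)) /\
      exists b, ~ K (fun n => A b (e a n))).
  { intro a. assert (heq : A a = step a (fun b => A (proj1_sig b))).
    { unfold A at 1. rewrite Fix_eq; [reflexivity|].
      intros x g g' hg. f_equal. extensionality b. apply hg. }
    destruct (proj2_sig (constructive_indefinite_description _ (hstep a))
                (fun b => A (proj1_sig b))) as [h1 [h2 h3]].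
    fold (step a) in h1, h2, h3. rewrite <- heq in h1, h2, h3.
    split; [exact h1|]. split.
    - intros b hb. exact (h2 (exist _ b hb)).
    - destruct h3 as [[b hb] | hb]; eauto. }
  (* Dropping the finite sets loses nothing: when the fibres of [f] are in [K], a finite set has its
     preimage in [K]. *)
  exists (fun S => ~ finite_set S /\ exists a, S = A a). split; [|split; [|split]].
  - intros S [_ [a ->]]. apply hA.
  - now intros S [h _].
  - intros S S' [_ [a ->]] [_ [b ->]] hne.
    destruct (tot a b) as [h | [h | h]].
    + destruct (hA b) as [_ [hab _]]. eapply finite_set_subset; [exact (hab a h)|]. tauto.
    + subst b. exfalso. apply hne. now intro x.
    + destruct (hA a) as [_ [hab _]]. exact (hab b h).
  - intros f hf. destruct (he f) as [a <-]. destruct (hA a) as [_ [_ [b hb]]].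
    exists (A b). split; [|exact hb]. split; [|now exists b].
    intro hfin. apply hb. now apply finite_preimage_in_ideal.
Qed.

(** * Mrówka spaces *)

Section MrowkaSpace.
Variable Ad : pset (pset nat).
Hypothesis hAd : forall A B, Ad A -> Ad B -> ~ ext_eq A B -> finite_set (fun n => A n /\ B n).

Lemma Pad_inter_finite (a b : {A | Ad A}) : a <> b ->
  finite_set (fun n => proj1_sig a n /\ proj1_sig b n).
Proof.
  intro h. apply hAd; [apply proj2_sig | apply proj2_sig |].
  intro he. apply h, proj1_sig_injective. extensionality n.
  apply propositional_extensionality, he.
Qed.

Lemma mrowka_open_Pnat (n : nat) : mrowka_open (fun q : mpoint Ad => q = Pnat n).
Proof. intros p ->. exists (fun q => q = Pnat n). now split. Qed.

Definition Pad_nbhd (a : {A | Ad A}) (F : pset nat) : pset (mpoint Ad) :=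
  fun q => q = Pad a \/ exists m, q = Pnat m /\ proj1_sig a m /\ ~ F m.

Definition Pinf_nbhd (F : pset nat) (G : pset {A | Ad A}) : pset (mpoint Ad) :=
  fun q => match q with
    | Pinf => True
    | Pad b => ~ G b
    | Pnat m => ~ F m /\ ~ (exists b, G b /\ proj1_sig b m)
    end.

Lemma mrowka_open_Pad (a : {A | Ad A}) (F : pset nat) :
  finite_set F -> mrowka_open (Pad_nbhd a F).
Proof.
  intros hF p [-> | [m [-> hm]]].
  - exists (Pad_nbhd a F). split; [now exists F | auto].
  - exists (fun q => q = Pnat m). split; [now intro q|]. intros q ->. right. now exists m.
Qed.

Lemma mrowka_open_Pinf (F : pset nat) (G : pset {A | Ad A}) :
  finite_set F -> finite_set G -> mrowka_open (Pinf_nbhd F G).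
Proof.
  intros hF hG [m | a |] hp.
  - exists (fun q => q = Pnat m). split; [now intro q|]. now intros q ->.
  (* Besides [F], remove the points that [a] shares with members of [G]. They are finitely many,
     since [a] itself is not in [G]. *)
  - set (F' := fun m => F m \/ exists b, G b /\ (proj1_sig a m /\ proj1_sig b m)).
    exists (Pad_nbhd a F'). split.
    + exists F'. split; [|now intro q].
      apply finite_set_union; [exact hF|]. destruct hG as [l hl].
      apply finite_set_subset with (fun m => exists b, In b l /\
        (b <> a /\ proj1_sig a m /\ proj1_sig b m)).
      * apply finite_set_list_union. intros b _.
        destruct (classic (b = a)) as [->|hne]; [now exists []|].
        eapply finite_set_subset; [exact (Pad_inter_finite hne)|]. tauto.
      * intros m [b [hb hm]]. exists b. repeat split; try tauto; auto.
        intros ->. now apply hp.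
    + intros q [-> | [m [-> [hm hn]]]]; [exact hp|]. unfold F' in hn. split; [tauto|].
      intros [b [hb hbm]]. apply hn. right. now exists b.
  - exists (Pinf_nbhd F G). split; [now exists F, G | auto].
Qed.

Lemma Pad_Pinf_disjoint (a : {A | Ad A}) (q : mpoint Ad) :
  ~ (Pad_nbhd a (fun _ => False) q /\ Pinf_nbhd (fun _ => False) (eq a) q).
Proof.
  intros [[-> | [m [-> [h1 _]]]] h]; [now apply h|]. apply h. now exists a.
Qed.

Lemma mrowka_hausdorff : hausdorff (@mrowka_open Ad).
Proof.
  assert (sym : forall p q : mpoint Ad,
    (exists U V, mrowka_open U /\ mrowka_open V /\ U p /\ V q /\ forall r, ~ (U r /\ V r)) ->
    exists U V, mrowka_open U /\ mrowka_open V /\ U q /\ V p /\ forall r, ~ (U r /\ V r)).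
  { intros p q [U [V [h1 [h2 [h3 [h4 h5]]]]]]. exists V, U. repeat split; auto.
    intros r [h h']. now apply (h5 r). }
  assert (fin0 : forall U : Type, finite_set (fun _ : U => False)).
  { intro U. now exists []. }
  assert (fin1 : forall (U : Type) (u : U), finite_set (eq u)).
  { intros U u. exists [u]. intros v <-. now left. }
  assert (hnat : forall n (q : mpoint Ad), Pnat n <> q ->
    exists U V, mrowka_open U /\ mrowka_open V /\ U (Pnat n) /\ V q /\ forall r, ~ (U r /\ V r)).
  { intros n q hne. exists (fun q => q = Pnat n). destruct q as [m | a |].
    - exists (fun q => q = Pnat m).
      split; [apply mrowka_open_Pnat|]. split; [apply mrowka_open_Pnat|].
      repeat split; auto. intros r [-> h]. auto.
    - exists (Pad_nbhd a (eq n)).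
      split; [apply mrowka_open_Pnat|]. split; [now apply mrowka_open_Pad|].
      split; [reflexivity|]. split; [now left|].
      intros r [-> [h | [m [h [_ hm]]]]]; [easy|]. injection h as <-. now apply hm.
    - exists (Pinf_nbhd (eq n) (fun _ => False)).
      split; [apply mrowka_open_Pnat|]. split; [now apply mrowka_open_Pinf|].
      split; [reflexivity|]. split; [exact Logic.I|].
      intros r [-> [h _]]. now apply h. }
  assert (hinf : forall a : {A | Ad A}, exists U V,
    mrowka_open U /\ mrowka_open V /\ U (Pad a) /\ V Pinf /\ forall r, ~ (U r /\ V r)).
  { intro a. exists (Pad_nbhd a (fun _ => False)), (Pinf_nbhd (fun _ => False) (eq a)).
    split; [now apply mrowka_open_Pad|]. split; [now apply mrowka_open_Pinf|].
    split; [now left|]. split; [exact Logic.I|]. apply Pad_Pinf_disjoint. }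
  intros p q hne. destruct p as [n | a |]; [now apply hnat | |];
    (destruct q as [m | b |]; [apply sym, hnat; congruence | |]); try congruence; auto.
  assert (hab : a <> b) by congruence.
  exists (Pad_nbhd a (fun m => proj1_sig a m /\ proj1_sig b m)), (Pad_nbhd b (fun _ => False)).
  split; [now apply mrowka_open_Pad, Pad_inter_finite|].
  split; [now apply mrowka_open_Pad|].
  split; [now left|]. split; [now left|].
  intros r [[-> | [m [-> [h1 h2]]]] [h | [k [h [h3 _]]]]]; try congruence.
  injection h as <-. tauto.
Qed.

End MrowkaSpace.

(** * Convergence in the space of the constructed family *)

Section Separation.
Variables (K J Ad : pset (pset nat)).
Hypotheses (hK : is_ideal K) (hdiag : diagonalizable K) (hJ : is_ideal J)
  (hAdJ : forall A, Ad A -> J A) (hAdinf : forall A, Ad A -> ~ finite_set A)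
  (hAd : forall A B, Ad A -> Ad B -> ~ ext_eq A B -> finite_set (fun n => A n /\ B n))
  (hcatch : forall f, (forall m, K (fun n => f n = m)) ->
     exists A, Ad A /\ ~ K (fun n => A (f n))).

(** This is the maximality of [Ad]. An injective enumeration of [B] has finite fibres, and a
    positive preimage of [A] under it is infinite. *)
Lemma family_meets_infinite (B : pset nat) :
  ~ finite_set B -> exists A, Ad A /\ ~ finite_set (fun n => A n /\ B n).
Proof.
  intro hB. destruct (choice _ (fun n => rank_surjective n hB)) as [f hf].
  assert (hinj : forall m n, f m = f n -> m = n).
  { intros m n h. rewrite <- (proj2 (hf m)), <- (proj2 (hf n)). now f_equal. }
  destruct (hcatch f) as [A [hA hpos]].
  - intro m. apply (ideal_finite hK).
    apply (finite_set_preimage f) with (eq m); [exists [m]; intros k <-; now left | auto | auto].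
  - exists A. split; [exact hA|]. intro hfin. apply hpos, (ideal_finite hK).
    apply (finite_set_preimage f) with (1 := hfin); [|auto].
    intros n hn. split; [exact hn | apply hf].
Qed.

Lemma separating_mrowka_family : mrowka_family Ad.
Proof.
  split; [|split; assumption].
  intros [l hl].
  (* The list may contain sets outside [Ad]; keeping only those in [J] leaves a union in [J], whose
     complement is infinite. *)
  destruct (@family_meets_infinite (fun n => ~ exists B, In B l /\ (J B /\ B n))) as [A [hA hfin]].
  - intro hfin. apply hJ.
    apply (ideal_subset hJ) with (fun n => (exists B, In B l /\ (J B /\ B n)) \/
      ~ exists B, In B l /\ (J B /\ B n)).
    + apply (ideal_union hJ); [|now apply (ideal_finite hJ)].
      apply (ideal_list_union hJ). intros B _.
      destruct (classic (J B)) as [h | h].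
      * apply (ideal_subset hJ) with (1 := h). tauto.
      * apply (ideal_finite hJ). exists []. tauto.
    + intros n _. apply classic.
  - apply hfin. exists []. intros n [hn hno]. apply hno.
    destruct (hl A hA) as [B [hB he]]. exists B. split; [exact hB|].
    split; [|now apply he]. apply (ideal_subset hJ) with (1 := hAdJ hA). apply he.
Qed.

Lemma mrowka_convergent_subsequence (s : nat -> mpoint Ad) :
  exists A, ~ K A /\ exists p, converges_on (@mrowka_open Ad) s A p.
Proof.
  destruct (classic (exists p, ~ K (fun n => s n = p))) as [[p hp] | hfib].
  { exists (fun n => s n = p). split; [exact hp|]. exists p.
    intros U _ hU. exists []. intros n [-> hn]. now apply hn. }
  assert (hfib' : forall p, K (fun n => s n = p)).
  { intro p. apply NNPP. intro h. apply hfib. now exists p. }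
  set (C := fun n => forall m, s n <> Pnat m).
  destruct (classic (K C)) as [hC | hC].
  (* The default 0 is used only on [C], which is in [K], so the fibres of [f] remain in [K]. *)
  - set (f := fun n => match s n with Pnat m => m | _ => 0 end).
    assert (hf : forall n, ~ C n -> s n = Pnat (f n)).
    { intros n hn. unfold f. destruct (s n) as [m | a |] eqn:E; [reflexivity | |];
        exfalso; apply hn; intro m; rewrite E; discriminate. }
    assert (hfK : forall m, K (fun n => f n = m)).
    { intro m. apply (ideal_subset hK) with (fun n => s n = Pnat m \/ C n).
      - now apply (ideal_union hK).
      - intros n <-. destruct (classic (C n)); auto. }
    destruct (hcatch f hfK) as [A [hA hpos]].
    (* On [Z] the map [f] is finite-to-one with values in [A], hence [s] tends to the point [A]. *)
    destruct (hdiag (fun m n => f n = m) (@positive_diff _ _ hK _ _ hpos hC))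
      as [Z [hZ [hZpos hfin]]];
      [exact hfK|].
    exists Z. split; [exact hZpos|]. exists (Pad (exist _ A hA)). intros U hU hUA.
    destruct (hU _ hUA) as [V [[F [[l hl] hV]] hVU]].
    apply finite_set_subset with (fun n => exists m, In m l /\ (Z n /\ f n = m)).
    + apply finite_set_list_union. auto.
    + intros n [hn hUn]. exists (f n). split; [|auto]. apply hl. apply NNPP. intro hF.
      apply hUn, hVU, hV. right. exists (f n). destruct (hZ n hn) as [h1 h2].
      split; [now apply hf | now split].
  (* On [Z] each point is taken finitely often, and a basic neighbourhood of infinity omits only
     finitely many members of [Ad]. *)
  - destruct (hdiag (fun m n => s n = s m) hC) as [Z [hZ [hZpos hfin]]]; [auto|].
    exists Z. split; [exact hZpos|]. exists Pinf. intros U hU hUinf.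
    destruct (hU _ hUinf) as [V [[F [G [_ [[l hl] hV]]]] hVU]].
    apply finite_set_subset with (fun n => exists a, In a l /\ (Z n /\ s n = Pad a)).
    + apply finite_set_list_union. intros a _.
      destruct (classic (exists m, s m = Pad a)) as [[m hm] | hn].
      * rewrite <- hm. apply hfin.
      * exists []. intros n [_ h]. apply hn. now exists n.
    + intros n [hn hUn]. assert (hVn : ~ V (s n)) by auto.
      rewrite hV in hVn. destruct (s n) as [m | a |] eqn:E.
      * destruct (hZ n hn m E).
      * apply NNPP in hVn. exists a. auto.
      * tauto.
Qed.

(** With a limit in [nat], [A] would be finite; with a limit [a] in [Ad], it would be almost
    contained in [a], a member of [J]. With limit infinity, it would meet every member of [Ad] in a
    finite set, against maximality. *)
Lemma mrowka_no_convergent_subsequence (A : pset nat) (p : mpoint Ad) :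
  ~ J A -> ~ converges_on (@mrowka_open Ad) Pnat A p.
Proof.
  intros hA hp. destruct p as [m | a |].
  - apply hA. apply (ideal_subset hJ) with
      (fun n => (A n /\ Pnat n <> Pnat m :> mpoint Ad) \/ n = m).
    + apply (ideal_union hJ); apply (ideal_finite hJ).
      * exact (hp _ (@mrowka_open_Pnat Ad m) eq_refl).
      * exists [m]. intros n ->. now left.
    + intros n hn. destruct (Nat.eq_dec n m) as [->|h]; [now right | left].
      split; congruence.
  - apply hA. assert (h0 : finite_set (fun _ : nat => False)) by now exists [].
    assert (hfin := hp _ (@mrowka_open_Pad Ad a _ h0) (or_introl eq_refl)).
    apply (ideal_subset hJ) with
      (fun n => (A n /\ ~ Pad_nbhd a (fun _ => False) (Pnat n)) \/ proj1_sig a n).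
    + apply (ideal_union hJ); [now apply (ideal_finite hJ) | apply hAdJ, proj2_sig].
    + intros n hn. destruct (classic (proj1_sig a n)) as [h | h]; [now right | left].
      split; [exact hn|]. intros [h' | [m [h' [h'' _]]]]; [discriminate|].
      injection h' as <-. auto.
  - destruct (@family_meets_infinite A) as [B [hB hinf]].
    { intro h. now apply hA, (ideal_finite hJ). }
    set (b := exist _ B hB : {A | Ad A}). apply hinf.
    assert (h0 : finite_set (fun _ : nat => False)) by now exists [].
    assert (h1 : finite_set (eq b)) by (exists [b]; intros d <-; now left).
    eapply finite_set_subset;
      [exact (hp _ (mrowka_open_Pinf hAd h0 h1) Logic.I)|].
    intros n [hBn hAn]. split; [exact hAn|]. intros [_ h]. apply h. now exists b.
Qed.

End Separation.

(** * Transport of ideals to the natural numbers *)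

Section Transport.
Variables (X : Type) (I : pset (pset X)) (f : nat -> X) (g : X -> nat).
Hypotheses (hgf : forall n, g (f n) = n) (hfg : forall x, f (g x) = x).

Definition push_ideal : pset (pset nat) := fun S => I (fun x => S (g x)).

Lemma push_ideal_is_ideal : is_ideal I -> is_ideal push_ideal.
Proof.
  intro hI. unfold push_ideal. split; [|split; [|split]].
  - intros A B hA hAB. apply (ideal_subset hI) with (1 := hA). auto.
  - intros A B hA hB. exact (ideal_union hI _ _ hA hB).
  - intros A hA. apply (ideal_finite hI).
    apply (finite_set_preimage g) with (1 := hA); auto. intros x y _ _. now apply (cancel_injective g f).
  - apply hI.
Qed.

Lemma push_ideal_comp (B : pset X) : is_ideal I -> push_ideal (fun n => B (f n)) <-> I B.
Proof.
  intro hI. unfold push_ideal.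
  split; intro h; apply (ideal_subset hI) with (1 := h); intro x; now rewrite hfg.
Qed.

Lemma push_ideal_coanalytic : is_ideal I -> coanalytic_ideal I -> coanalytic_ideal push_ideal.
Proof.
  intros hI hco. destruct (coanalytic_ideal_code hI hco) as [c [hcont hcode]].
  right. exists (fun h n => c h (f n)). split.
  - intros n. apply hcont.
  - intro s. unfold push_ideal. rewrite (hcode (fun x => s (g x))).
    split; intros [h hh]; exists h.
    + extensionality n. now rewrite hh, hgf.
    + extensionality x. now rewrite <- hh, hfg.
Qed.

Lemma push_ideal_diagonalizable : is_ideal I -> diagonalizable I -> diagonalizable push_ideal.
Proof.
  intros hI hdiag A E hA hE.
  destruct (hdiag (fun x => A (g x)) (fun n x => E n (g x)) hA hE) as [Z [hZ [hpos hfin]]].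
  exists (fun n => Z (f n)). split; [|split].
  - intros n hn. rewrite <- hgf. now apply hZ.
  - now rewrite push_ideal_comp.
  - intro n. apply (finite_set_preimage f) with (1 := hfin n).
    + intro m. now rewrite hgf.
    + intros x y _ _. now apply (cancel_injective f g).
Qed.

End Transport.

Theorem theorem9p4 (X Y : Type) (I I' : pset (pset X)) (J : pset (pset Y)) :
  MA_sigma_centered ->
  countably_infinite X -> countably_infinite Y ->
  is_ideal I -> is_ideal I' -> is_ideal J ->
  (forall A, I A -> I' A) ->
  coanalytic_ideal I' -> hereditary_weakP I' ->
  ~ katetov_le J I' ->
  exists Ad : pset (pset nat), mrowka_family Ad /\
    FinBW (@mrowka_open Ad) I /\ ~ FinBW (@mrowka_open Ad) J.
Proof.
  intros MA hX [fY [gY [hgfY hfgY]]] _ hI' hJ hII' hco hW hJI'.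
  assert (hdiag := hereditary_weakP_diagonalizable hX hI' hW).
  destruct hX as [fX [gX [hgfX hfgX]]].
  assert (hK := push_ideal_is_ideal fX gX hfgX hI').
  assert (hKco := push_ideal_coanalytic fX gX hgfX hfgX hI' hco).
  assert (hKdiag := push_ideal_diagonalizable fX gX hgfX hfgX hI' hdiag).
  assert (hJ' := push_ideal_is_ideal fY gY hfgY hJ).
  destruct (almost_disjoint_family MA hK hKco hKdiag hJ') as [Ad [hAdJ [hinf [hAd hcatch]]]].
  (* Conjugating by the enumerations turns a reduction between the transported ideals into one of
     [J] to [I']. *)
  { intros [h hh]. apply hJI'. exists (fun x => fY (h (gX x))). intros B hB.
    apply (hh (fun n => B (fY n))). now apply push_ideal_comp. }
  exists Ad. split; [|split; [split|]].
  - now apply separating_mrowka_family with (push_ideal I' gX) (push_ideal J gY).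
  - now apply mrowka_hausdorff.
  - intro s.
    destruct (mrowka_convergent_subsequence hK hKdiag hcatch (fun n => s (fX n)))
      as [A [hA [p hp]]].
    (* A set positive for [I'] is positive for the smaller ideal [I]. *)
    exists (fun x => A (gX x)). split; [intro h; now apply hA, hII'|].
    exists p. intros U hU hUp. apply (finite_set_preimage gX) with (1 := hp U hU hUp).
    + intros x [h1 h2]. now rewrite hfgX.
    + intros x y _ _. now apply (cancel_injective gX fX).
  - intros [_ h]. destruct (h (fun y => Pnat (gY y))) as [A [hA [p hp]]].
    apply (mrowka_no_convergent_subsequence hK hJ' hAdJ hAd hcatch
      (A := fun n => A (fY n)) (p := p)).
    + now rewrite push_ideal_comp.
    + intros U hU hUp. apply (finite_set_preimage fY) with (1 := hp U hU hUp).
      * intros n [h1 h2]. now rewrite hgfY.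
      * intros m n _ _. now apply (cancel_injective fY gY).
Qed.
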